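(* Let $\{X_\gamma\}_{\gamma\in\Gamma}$ be an arbitrary family of Tychonoff spaces, each of which is a $W$-space. Then the product space $\prod_{\gamma\in\Gamma}X_\gamma$ (with the product topology) is $\kappa$-Fréchet-Urysohn.
   Context: All spaces are Tychonoff topological spaces (completely regular and Hausdorff). **$W$-game.** Let $X$ be a space and $x\in X$. The game $W(X,x)$ is played by two players in rounds indexed by $n\in\omega=\{0,1,2,\dots\}$. In the $n$-th round, Player I picks an open neighborhood $U_n$ of $x$, and Player II responds by choosing a point $x_n\in U_n$. Player I wins if the sequence $(x_n)_{n\in\omega}$ converges to $x$; otherwise Player II wins. **Strategies.** Let $\tau(X,x)$ be the family of all open neighborhoods of $x$ and let $X^{<\omega}$ be the set of all finite sequences in $X$ (including the empty one). A strategy for Player I is a function $\sigma:X^{<\omega}\to\tau(X,x)$. A finite sequence $(x_1,\dots,x_n)$ is a $\sigma$-sequence if it is empty, or if $x_1\in\sigma(\emptyset)$ and $x_{i+1}\in\sigma(x_1,\dots,x_i)$ for $i=1,\dots,n-1$. An infinite sequence is a $\sigma$-sequence if all its finite initial segments are. The strategy $\sigma$ is winning if every infinite $\sigma$-sequence converges to $x$. **$W$-space.** A point $x\in X$ is a $W$-point if Player I has a winning strategy in $W(X,x)$. The space $X$ is a $W$-space if all of its points are $W$-points. **$\kappa$-Fréchet-Urysohn.** A space $X$ is $\kappa$-Fréchet-Urysohn if for every open set $U\subset X$ and every $x\in\overline{U}$ there is a sequence $(x_n)_{n\in\omega}$ of points of $U$ converging to $x$. Here ''$\kappa$'' is just part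 of the name and does not denote a cardinal. *)

(* Defs.v *)
From mathcomp Require Export all_boot all_order all_algebra.
From mathcomp Require Export all_classical all_reals all_analysis.
Export numFieldNormedType.Exports.

Set Implicit Arguments.
Unset Strict Implicit.
Unset Printing Implicit Defensive.

Local Open Scope classical_set_scope.

(** Spaces are [topologicalType]s rather than pointed ones, so the empty space
    is allowed.  By [uniform_separatorP], [completely_regular_space] says that
    points and closed sets are separated by continuous [0, 1]-valued maps. *)
Definition tychonoff_space (X : topologicalType) : Prop :=
  completely_regular_space X /\ hausdorff_space X.

Section WGame.
Context {X : topologicalType}.
Implicit Types (x : X) (sigma : seq X -> set X).

(** [sigma s] is Player I's move after Player II has played the points of [s],
    in this order. *)
Definition W_strategy x sigma : Prop := forall s, open_nbhs x (sigma s).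

(** The second argument of [nth] is a default value which is never used. *)
Definition finite_sigma_sequence x sigma (s : seq X) : Prop :=
  forall i, (i < size s)%N -> sigma (take i s) (nth x s i).

Definition sigma_sequence x sigma (u : nat -> X) : Prop :=
  forall n, finite_sigma_sequence x sigma (mkseq u n).

Definition W_winning x sigma : Prop :=
  forall u : nat -> X, sigma_sequence x sigma u -> u @ \oo --> x.

Definition W_point x : Prop :=
  exists sigma, W_strategy x sigma /\ W_winning x sigma.

End WGame.

Definition W_space (X : topologicalType) : Prop := forall x : X, W_point x.

Definition kappa_frechet_urysohn (X : topologicalType) : Prop :=
  forall (U : set X) (x : X), open U -> closure U x ->
  exists u : nat -> X, (forall n, U (u n)) /\ u @ \oo --> x.

(* Main.v *)
(** Run all the games [W(X g, x g)] simultaneously, but let each of them start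
    only when its coordinate becomes active.  At every round finitely many
    coordinates are active, so Player I's current moves on these coordinates
    define a neighbourhood of [x], which meets [U] in some point [y].  As [U] is
    open, only finitely many coordinates of [y] matter for its membership in
    [U]: activate these and reset all the inactive ones to [x].  Along the
    resulting sequence, a coordinate which is never activated is constantly that
    of [x], and any other one is, from its activation on, a play of a winning
    strategy. *)
Require Import Defs.
From mathcomp Require Import finmap.

Set Implicit Arguments.
Unset Strict Implicit.
Unset Printing Implicit Defensive.

Local Open Scope classical_set_scope.

Lemma mkseq_sigma_sequence (X : topologicalType) (x : X) sigma (v : nat -> X) :
  (forall n, sigma (mkseq v n) (v n)) -> sigma_sequence x sigma v.
Proof.
move=> sv n i; rewrite size_mkseq => lt_in.
rewrite nth_mkseq// -map_take take_iota (minn_idPl (ltnW lt_in)); exact: sv.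
Qed.

Lemma cvg_prod_topology (I : Type) (X : I -> topologicalType)
    (F : set_system (prod_topology X)) (y : prod_topology X) : Filter F ->
  (forall i, z i @[z --> F] --> y i) -> F --> y.
Proof.
move=> FF Fy; apply/cvg_sup => i A.
have /= -> := @nbhsE (initial_topology (fun f : prod_topology X => f i)) y.
case=> B [[C oC <-] Cy] sBA; apply: filterS sBA _.
by apply: Fy; exact: open_nbhs_nbhs.
Qed.

Lemma prod_topology_proj_continuous (I : Type) (X : I -> topologicalType)
    (y : prod_topology X) i : z i @[z --> y] --> y i.
Proof.
have /cvg_sup/(_ i) yi : nbhs y --> y by [].
move=> A yA; apply: yi.
exact: (@initial_continuous _ _ (fun f : prod_topology X => f i) y A yA).
Qed.

(** The sets containing every point that agrees with [y] on some finite set of coordinates form a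
    filter. It converges to [y] coordinatewise, hence in the product, so it contains all
    neighbourhoods of [y]. *)
Lemma nbhs_prod_finite_support (I : choiceType) (X : I -> topologicalType)
    (y : prod_topology X) (A : set (prod_topology X)) : nbhs y A ->
  exists G : {fset I}, forall z, (forall i, i \in G -> z i = y i) -> A z.
Proof.
pose F : set_system (prod_topology X) := [set B : set (prod_topology X) | exists G : {fset I},
  forall z : prod_topology X, (forall i, i \in G -> z i = y i) -> B z].
have FF : Filter F.
  split=> [|B C [G GB] [H HC]|B C sBC [G GB]]; first by exists fset0.
    exists (G `|` H)%fset => z zy; split.
      by apply: GB => i iG; apply: zy; rewrite in_fsetU iG.
    by apply: HC => i iH; apply: zy; rewrite in_fsetU iH orbT.
  by exists G => z /GB /sBC.
have Fy : F --> y.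
  apply: cvg_prod_topology => i B /nbhs_singleton Byi.
  by exists [fset i]%fset => z /= ->//; rewrite in_fset1.
exact: Fy.
Qed.

Section SimultaneousGames.
Variables (I : choiceType) (X : I -> topologicalType).
Variables (U : set (prod_topology X)) (x : prod_topology X).
Variable sigma : forall i, seq (X i) -> set (X i).
Hypotheses (oU : open U) (Ux : closure U x).
Hypothesis sigmaW : forall i, W_strategy (x i) (@sigma i).

(* Last point played, active coordinates, and history of each game. *)
Let state : Type := prod_topology X * {fset I} * (forall i, seq (X i)).

(** Histories grow only on [D], the coordinates active before the round: on those newly added in
    [E], [z] need not obey [sigma]. *)
Definition round (s t : state) : Prop :=
  let: (_, D, h) := s in let: (z, E, k) := t in
  [/\ U z, {subset D <= E}, forall i, i \notin E -> z i = x i,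
      forall i, i \in D -> sigma (h i) (z i) &
      forall i, k i = if i \in D then rcons (h i) (z i) else h i].

Lemma round_total s : exists t, round s t.
Proof.
case: s => -[x0 D] h.
have [y [Uy Dy]] : U `&` \bigcap_(i in [set` D])
    [set z : prod_topology X | sigma (h i) (z i)] !=set0.
  apply: Ux; apply: filter_bigI => i _.
  exact: (prod_topology_proj_continuous (open_nbhs_nbhs (sigmaW (h i)))).
have [G GU] := nbhs_prod_finite_support (open_nbhs_nbhs (conj oU Uy)).
pose z : prod_topology X := fun i => if i \in (D `|` G)%fset then y i else x i.
exists (z, (D `|` G)%fset,
  fun i => if i \in D then rcons (h i) (z i) else h i); split=> //.
- by apply: GU => i iG; rewrite /z in_fsetU iG orbT.
- by move=> i iD; rewrite in_fsetU iD.
- by move=> i /negbTE iDG; rewrite /z iDG.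
- by move=> i iD; rewrite /z in_fsetU iD; exact: Dy.
Qed.

Lemma open_closure_cvg_seq : (forall i, W_winning (x i) (@sigma i)) ->
  exists u : nat -> prod_topology X, (forall n, U (u n)) /\ u @ \oo --> x.
Proof.
move=> winning.
have [s [s0 sR]] := dependent_choice (fun s => cid (round_total s))
  (x, fset0, fun=> [::]).
(* The point of round [n] is stored in state [n.+1]; the [x] in the initial state is a placeholder
   and may lie outside [U]. *)
pose u n : prod_topology X := (s n.+1).1.1.
pose D n := (s n).1.2; pose h n := (s n).2.
have {}sR n : [/\ U (u n), {subset D n <= D n.+1},
    forall i, i \notin D n.+1 -> u n i = x i,
    forall i, i \in D n -> sigma (h n i) (u n i) &
    forall i, h n.+1 i = if i \in D n then rcons (h n i) (u n i) else h n i].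
  by move: (sR n); rewrite /u /D /h; case: (s n) (s n.+1) => -[? ?] ? [[? ?] ?].
have h0 i : h 0 i = [::] by rewrite /h s0.
exists u; split=> [n|]; first by case: (sR n).
apply: cvg_prod_topology => i; change (u n i @[n --> \oo] --> x i).
have [/= iD|niD] := pselect (exists n, i \in D n); last first.
  apply: cvg_near_cst; apply: nearW => n.
  by have [_ _ + _ _] := sR n; apply; apply/negP => iD; apply: niD; exists n.+1.
(* At [m], the first stage where [i] is active, its history is still empty, so the tail of [u] from
   [m] on is a full play at [i]. *)
case: (ex_minnP iD) => m iDm minm.
have hm : h m i = [::].
  have : forall n, (n <= m)%N -> h n i = [::]; last exact.
  elim=> [//|n IH] lt_nm; have [_ _ _ _ ->] := sR n.
  by rewrite ifN ?IH 1?ltnW//; apply: contraL lt_nm => /minm; rewrite -leqNgt.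
have iDmk k : i \in D (m + k)%N.
  elim: k => [|k IH]; first by rewrite addn0.
  by rewrite addnS; have [_ sub _ _ _] := sR (m + k)%N; exact: sub.
pose v k := u (m + k)%N i.
have hmk k : h (m + k)%N i = mkseq v k.
  elim: k => [|k IH]; first by rewrite addn0.
  by rewrite addnS mkseqS -IH; have [_ _ _ _ ->] := sR (m + k)%N; rewrite iDmk.
have /winning vx : sigma_sequence (x i) (@sigma i) v.
  apply: mkseq_sigma_sequence => k; rewrite -hmk.
  by have [_ _ _ + _] := sR (m + k)%N; apply.
move=> A /vx[N _ NA]; exists (m + N)%N => // n /= mNn.
have := NA (n - m)%N; rewrite /= /v subnKC ?(leq_trans (leq_addr _ _) mNn)//.
by apply; rewrite leq_subRL// (leq_trans (leq_addr _ _) mNn).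
Qed.

End SimultaneousGames.

Theorem theorem3p3 (Gamma : Type) (X : Gamma -> topologicalType)
    (tychX : forall g : Gamma, tychonoff_space (X g))
    (WX : forall g : Gamma, W_space (X g)) :
  kappa_frechet_urysohn (prod_topology X).
Proof.
move=> U x oU Ux.
have /all_tag[sigma /all_and2[sigmaW winning]] g := cid (WX g (x g)).
(* [{classic Gamma}] gives the arbitrary index type the choice structure that finite sets of indices
   require. *)
exact: (@open_closure_cvg_seq {classic Gamma} X U x sigma).
Qed.
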